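(* Let $\boldsymbol{x}(k)=A(k)\otimes\boldsymbol{x}(k-1)$, $k=1,2,\ldots$, $\boldsymbol{x}(0)=(0,\ldots,0)^T$, be the stochastic dynamical system of an acyclic fork-join queueing network with $n$ nodes, where $$A(k)=(E\oplus\mathcal{T}_k\otimes G^{T})^{\otimes p}\otimes\mathcal{T}_k,\qquad \mathcal{T}_k=\mathrm{diag}(\tau_{1k},\ldots,\tau_{nk}),$$ $G$ is the standard adjacency matrix of the (acyclic, oriented) network graph, $p$ is the length of the longest path in that graph, and the service times $\tau_{ik}$ are non-negative random variables with $\mathbb{E}[\tau_{ik}]<\infty$ and finite variance $\mathbb{D}[\tau_{ik}]<\infty$ such that the matrices $\mathcal{T}_1,\mathcal{T}_2,\ldots$ are independent and identically distributed. Then the mean cycle time $\gamma$ of the system satisfies the double inequality $$\|\mathbb{E}[\mathcal{T}_1]\|_{\oplus}\;\le\;\gamma\;\le\;\mathbb{E}\|\mathcal{T}_1\|_{\oplus}.$$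
   Context: Let $\varepsilon=-\infty$ and $\underline{\mathbb{R}}=\mathbb{R}\cup\{\varepsilon\}$, with $x\oplus y=\max(x,y)$ and $x\otimes y=x+y$ (so $x\otimes\varepsilon=\varepsilon\otimes x=\varepsilon$). For matrices over $\underline{\mathbb{R}}$, $(X\oplus Y)_{ij}=x_{ij}\oplus y_{ij}$ and $(X\otimes Y)_{ij}=\max_k(x_{ik}+y_{kj})$. $E$ is the identity matrix: diagonal entries $0$, off-diagonal entries $\varepsilon$. $X^{\otimes 0}=E$ and $X^{\otimes q}$ is the $q$-fold $\otimes$-product for $q\ge1$. $\mathrm{diag}(d_1,\ldots,d_n)$ is the matrix with diagonal entries $d_i$ and off-diagonal entries $\varepsilon$. The norm of a matrix is $\|X\|_{\oplus}=\max_{i,j}x_{ij}$ (also applied to vectors). $\mathbb{E}[X]$ denotes the entrywise expectation of a random matrix $X$ (with $\mathbb{E}[\varepsilon]=\varepsilon$). The network graph is an oriented acyclic graph with vertex set $\{1,\ldots,n\}$; its standard adjacency matrix $G$ has entry $0$ at $(i,j)$ if $(i,j)$ is an edge and $\varepsilon$ otherwise. The length of a path is its number of edges. Here $\tau_{ik}$ is the service time of the $k$th customer at node $i$ and $x_i(k)$ (the $i$th entry of $\boldsymbol{x}(k)$) is the $k$th departure epoch from node $i$. The service times $\tau_{1k},\ldots,\tau_{nk}$ for the same $k$ need not be independent of each other. Put $A_k=A(k)\otimes\cdots\otimes A(1)$, so that $\|\boldsymbol{x}(k)\|_{\oplus}=\|A_k\|_{\oplus}$. The mean cycle time is the constant $$\gamma=\lim_{k\to\infty}\frac1k\|A_k\|_{\oplus}\quad\text{with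 probability }1,$$ which exists, and also equals $\lim_{k\to\infty}\frac1k\mathbb{E}\|A_k\|_{\oplus}$, by Kingman's subadditive ergodic theorem. *)

(* Defs.v *)
From HB Require Import structures.
From mathcomp Require Import all_boot all_order all_algebra.
From mathcomp Require Import all_classical all_reals all_analysis.

Set Implicit Arguments.
Unset Strict Implicit.
Unset Printing Implicit Defensive.

Import Order.TTheory GRing.Theory Num.Theory.
Import numFieldNormedType.Exports.

Local Open Scope classical_set_scope.
Local Open Scope ring_scope.
Local Open Scope ereal_scope.

(* Max-plus linear algebra over R U {-oo}, with scalars in [\bar R]: [maxe]   *)
(* is the sum and [+%E] the product, -oo being neutral for the former and     *)
(* absorbing for the latter. The value +oo never occurs in the matrices of    *)
(* the network, whose entries are built from reals and -oo.                   *)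
Section MaxPlus.
Context {R : realType}.

Definition mpadd m n (X Y : 'M[\bar R]_(m, n)) : 'M[\bar R]_(m, n) :=
  \matrix_(i, j) maxe (X i j) (Y i j).

Definition mpmul m n q (X : 'M[\bar R]_(m, n)) (Y : 'M[\bar R]_(n, q)) :
    'M[\bar R]_(m, q) :=
  \matrix_(i, j) \big[maxe/-oo]_(k < n) (X i k + Y k j).

Definition mpdiag n (d : 'I_n -> R) : 'M[\bar R]_n :=
  \matrix_(i, j) if i == j then (d i)%:E else -oo.

Definition mpid n : 'M[\bar R]_n := mpdiag (fun _ => 0%R).

Definition mppow n (X : 'M[\bar R]_n) (q : nat) : 'M[\bar R]_n :=
  iter q (mpmul X) (mpid n).

Definition mpnorm m n (X : 'M[\bar R]_(m, n)) : \bar R :=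
  \big[maxe/-oo]_(i < m) \big[maxe/-oo]_(j < n) X i j.

End MaxPlus.

Section Graph.
Variable n : nat.

(* [cycle g] also holds of loops [:: v] and of 2-cycles [:: v; w], so this    *)
(* makes [g] an oriented graph as well.                                       *)
Definition acyclic_graph (g : rel 'I_n) : Prop :=
  forall c : seq 'I_n, c != [::] -> ~~ cycle g c.

(* The path v :: s has [size s] edges.                                        *)
Definition longest_path_length (g : rel 'I_n) (p : nat) : Prop :=
  (exists v s, path g v s /\ size s = p) /\
  (forall v s, path g v s -> (size s <= p)%N).

Definition std_adjacency (R : realType) (g : rel 'I_n) : 'M[\bar R]_n :=
  \matrix_(i, j) if g i j then 0 else -oo.

End Graph.

Section RandomElements.
Context d d' (T : measurableType d) (T' : measurableType d') (R : realType).
Variable P : probability T R.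

Definition mutually_independent (X : nat -> T -> T') : Prop :=
  forall (J : seq nat) (B : nat -> set T'),
    uniq J -> (forall k, measurable (B k)) ->
    P [set w | forall k, k \in J -> B k (X k w)] =
    \prod_(k <- J) P (X k @^-1` B k).

Definition identically_distributed (X : nat -> T -> T') : Prop :=
  forall k l (B : set T'), measurable B -> P (X k @^-1` B) = P (X l @^-1` B).

End RandomElements.

(* Entrywise expectation; an entry equal to -oo has expectation -oo.          *)
Definition mpexpect d (T : measurableType d) (R : realType)
    (P : probability T R) m n (X : T -> 'M[\bar R]_(m, n)) :
    'M[\bar R]_(m, n) :=
  \matrix_(i, j) \int[P]_w X w i j.

Lemma mpexpect_Ny d (T : measurableType d) (R : realType)
    (P : probability T R) m n (X : T -> 'M[\bar R]_(m, n)) i j :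
  (forall w, X w i j = -oo) -> mpexpect P X i j = -oo.
Proof.
move=> XNy; rewrite mxE.
have -> : (fun w => X w i j) = cst -oo by apply/funext => w; rewrite XNy.
by rewrite integral_cst// [X in _ * X]probability_setT mule1.
Qed.

Section Network.
Context d (T : measurableType d) (R : realType) (P : probability T R).
Variables (n : nat) (g : rel 'I_n) (p : nat).

(* [tau i k] is the service time of the k-th customer at node i; customers    *)
(* are numbered from 1 and [tau i 0] is never used.                           *)
Variable tau : 'I_n -> nat -> {RV P >-> R}.

Definition service_matrix (k : nat) (w : T) : 'M[\bar R]_n :=
  mpdiag (fun i => tau i k w).

(* The diagonal of [service_matrix k w]; [n.-tuple R] carries the product     *)
(* sigma-algebra, i.e. the Borel sets of R^n.                                 *)
Definition service_vector (k : nat) (w : T) : n.-tuple R :=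
  [tuple tau i k w | i < n].

Definition transition_matrix (k : nat) (w : T) : 'M[\bar R]_n :=
  mpmul
    (mppow
       (mpadd (mpid n) (mpmul (service_matrix k w) (std_adjacency R g)^T)) p)
    (service_matrix k w).

Fixpoint departure_epochs (k : nat) (w : T) : 'cV[\bar R]_n :=
  if k is k'.+1 then mpmul (transition_matrix k w) (departure_epochs k' w)
  else const_mx 0.

Fixpoint transition_product (k : nat) (w : T) : 'M[\bar R]_n :=
  if k is k'.+1 then mpmul (transition_matrix k w) (transition_product k' w)
  else mpid n.

Definition mean_cycle_time (gamma : R) : Prop :=
  {ae P, forall w,
    (k%:R^-1)%:E * mpnorm (transition_product k w) @[k --> \oo] --> gamma%:E}.

Lemma mpnorm_departure_epochs (k : nat) (w : T) :
  mpnorm (departure_epochs k w) = mpnorm (transition_product k w).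
Proof.
have addmax (x : \bar R) m (F : 'I_m -> \bar R) :
    x + \big[maxe/-oo]_j F j = \big[maxe/-oo]_j (x + F j).
  by apply: big_morph => [y z|]; rewrite ?adde_maxr ?addeNy.
suff rowE i :
    departure_epochs k w i ord0 = \big[maxe/-oo]_j transition_product k w i j.
  by rewrite /mpnorm; apply: eq_bigr => i _; rewrite big_ord1 rowE.
elim: k i => [|k IHk] i /=.
  rewrite mxE; apply/eqP; rewrite eq_le; apply/andP; split.
    by apply: (le_trans _ (le_bigmax _ _ i)); rewrite !mxE eqxx.
  by apply/bigmax_leP; split=> // j _; rewrite !mxE; case: eqP; rewrite ?leNye.
rewrite mxE (eq_bigr (fun l => \big[maxe/-oo]_j
  (transition_matrix k.+1 w i l + transition_product k w l j))).
  by rewrite exchange_big; apply: eq_bigr => j _; rewrite mxE.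
by move=> l _; rewrite -addmax -IHk.
Qed.

Lemma mean_cycle_timeE (gamma : R) :
  mean_cycle_time gamma <->
  {ae P, forall w,
    (k%:R^-1)%:E * mpnorm (departure_epochs k w) @[k --> \oo] --> gamma%:E}.
Proof.
have E w : (fun k => (k%:R^-1)%:E * mpnorm (departure_epochs k w)) =
           (fun k => (k%:R^-1)%:E * mpnorm (transition_product k w)).
  by apply/funext => k; rewrite mpnorm_departure_epochs.
by split; apply: filterS => w; rewrite E.
Qed.

End Network.

(* Main.v *)
Require Import Defs.
From HB Require Import structures.
From mathcomp Require Import all_boot all_order all_algebra.
From mathcomp Require Import all_classical all_reals all_analysis.
From mathcomp Require Import measurable_realfun zify ring lra.

Import Order.TTheory GRing.Theory Num.Theory.
Import numFieldNormedType.Exports.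

Local Open Scope classical_set_scope.
Local Open Scope ring_scope.
Local Open Scope ereal_scope.

(** Every node i serves the customers 1, ..., k one after the other, so the k-th
   cycle ends no earlier than S_k(i) = tau_i1 + ... + tau_ik: this is the walk
   that stays at i, and it is read off the diagonal of A_k
   ([transition_product_diag_ge]). Conversely, an entry of A_k is the weight of a
   walk that, from one customer to the next, stays at its node and, within one
   customer, may follow edges of the network. Staying collects one service time
   per customer, hence at most the sum of M_j = max_i tau_ij over j <= k. The
   edges followed form a path of an acyclic network, so there are at most p of
   them in total, and not p for each customer: they add at most p L, where L
   bounds M_1, ..., M_k. Therefore
   [[
     S_k(i) <= ||A_k|| <= (M_1 + ... + M_k) + p L
   ]]
   for every i ([transition_product_norm_le]).

   It remains to divide by k. The sequences tau_i1, tau_i2, ... and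
   M_1, M_2, ... are both of the form f(V_1), f(V_2), ... for the i.i.d. vectors
   V_k of service times, and they are square integrable. By Chebyshev's
   inequality the sum of k terms is within e k of k times the mean, outside an
   event of probability O(1/k); the same inequality and a union bound show that
   each of the k terms is within e k of the mean, again outside an event of
   probability O(1/k). The second fact makes L = mean + e k an admissible bound,
   so that the boundary term p L costs only p e + o(1) after division by k.

   The comparison with gamma takes place at a single sample point. Events whose
   probabilities tend to 0 almost surely fail for arbitrarily large indices
   ([ae_frequently_notin]), so at almost every point both estimates hold together
   for arbitrarily large k ([iid_ae_frequently_close]), while ||A_k|| / k tends to
   gamma there: letting k run through these indices, and then e to 0, bounds
   gamma from both sides. *)

(** * Ranks in an acyclic graph *)

Section LongestPathRank.
Context {n : nat} {g : rel 'I_n} {p : nat}.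
Hypothesis gp : longest_path_length g p.

(** The rank of v is the length of a longest path that starts at v; prepending
   an edge to such a path makes it longer. *)
Lemma longest_path_rank :
  exists r : 'I_n -> nat, (forall v, (r v <= p)%N) /\
    (forall v w, g v w -> (r w < r v)%N).
Proof.
pose Q v l := `[< exists2 s, path g v s & size s = l >].
have Q0 v : exists l, Q v l by exists 0%N; apply/asboolP; exists [::].
have Qp v l : Q v l -> (l <= p)%N.
  by move=> /asboolP[s gs <-]; apply: gp.2 gs.
exists (fun v => ex_maxn (Q0 v) (Qp v)); split=> [v|v w gvw].
  by case: ex_maxnP => l /Qp.
case: (ex_maxnP (Q0 w) (Qp w)) => l /asboolP[s gs <-] _.
case: (ex_maxnP (Q0 v) (Qp v)) => l' _; apply.
by apply/asboolP; exists (w :: s) => //=; rewrite gvw.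
Qed.

End LongestPathRank.

(** * Upper and lower bounds in max-plus algebra *)

Section PotentialBound.
Context {R : realType} {n : nat}.
Implicit Types (X Y : 'M[\bar R]_n) (phi : 'I_n -> R) (a b c : R).

(** The entry (i, j) is the weight of the best walk from j to i, and c is what a
   walk may collect beyond the drop of the potential between its endpoints. Along a composition of walks the intermediate
   potentials cancel, so only the constants c accumulate: this is what keeps the
   contribution of the edges bounded uniformly in the number of customers. *)
Definition potential_le phi c X :=
  forall i j, X i j <= (c + phi j - phi i)%:E.

Lemma potential_le_mul phi a b X Y :
  potential_le phi a X -> potential_le phi b Y ->
  potential_le phi (a + b) (mpmul X Y).
Proof.
move=> aX bY i j; rewrite mxE; apply/bigmax_leP; split=> [|k _].
  exact: leNye.
apply: le_trans (leeD (aX i k) (bY k j)) _.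
by rewrite -EFinD lee_fin; lra.
Qed.

Lemma potential_le_id phi : potential_le phi 0 (mpid n).
Proof.
move=> i j; rewrite mxE; case: eqP => [->|_]; last exact: leNye.
by rewrite lee_fin; lra.
Qed.

Lemma potential_le_pow phi X q :
  potential_le phi 0 X -> potential_le phi 0 (mppow X q).
Proof.
move=> X0; elim: q => [|q IHq]; first exact: potential_le_id.
by rewrite -[0%R]addr0; exact: potential_le_mul.
Qed.

Lemma potential_le_norm phi a b X :
  (forall v, (0 <= phi v <= b)%R) -> potential_le phi a X ->
  mpnorm X <= (a + b)%:E.
Proof.
move=> phib aX; apply/bigmax_leP; split=> [|i _]; first exact: leNye.
apply/bigmax_leP; split=> [|j _]; first exact: leNye.
apply: le_trans (aX i j) _; rewrite lee_fin.
by have /andP[? ?] := phib i; have /andP[? ?] := phib j; lra.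
Qed.

End PotentialBound.

Section DiagonalBound.
Context {R : realType} {n : nat}.
Implicit Types (X Y : 'M[\bar R]_n) (i : 'I_n) (a b : R).

Lemma mpmul_diag_ge X Y i a b :
  a%:E <= X i i -> b%:E <= Y i i -> (a + b)%:E <= mpmul X Y i i.
Proof.
move=> aX bY; rewrite mxE EFinD; apply: le_trans (leeD aX bY) _.
exact: (le_bigmax _ (fun k => X i k + Y k i)).
Qed.

Lemma mpid_diag_ge i : (0%R : R)%:E <= mpid n i i.
Proof. by rewrite mxE eqxx. Qed.

Lemma mppow_diag_ge X i q :
  (0%R)%:E <= X i i -> (0%R)%:E <= mppow X q i i.
Proof.
move=> X0; elim: q => [|q IHq]; first exact: mpid_diag_ge.
by rewrite -[0%R in leLHS]addr0; exact: mpmul_diag_ge.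
Qed.

Lemma mpnorm_ge X i j : X i j <= mpnorm X.
Proof.
apply: le_trans (le_bigmax _ (fun l => \big[maxe/-oo]_(j < n) X l j) i).
exact: (le_bigmax _ (X i)).
Qed.

Lemma mpnorm_diag (t : n.-tuple R) (i0 : 'I_n) :
  mpnorm (mpdiag (tnth t)) = (\big[Num.max/tnth t i0]_i tnth t i)%:E.
Proof.
rewrite -EFin_bigmax; apply/eqP; rewrite eq_le; apply/andP; split.
  apply/bigmax_leP; split=> [|i _]; first exact: leNye.
  apply/bigmax_leP; split=> [|j _]; first exact: leNye.
  rewrite mxE; case: eqP => [_|_]; last exact: leNye.
  exact: (le_bigmax _ (fun k => (tnth t k)%:E)).
have tle i : (tnth t i)%:E <= mpnorm (mpdiag (tnth t)).
  by apply: le_trans (mpnorm_ge _ i i); rewrite mxE eqxx.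
by apply/bigmax_leP; split.
Qed.

End DiagonalBound.

(** * The sample-path inequality *)

Section NetworkBounds.
Context {d} {T : measurableType d} {R : realType} {P : probability T R}.
Context {n : nat} (g : rel 'I_n) (p : nat).
Variables (tau : 'I_n -> nat -> {RV P >-> R}) (w : T).

(** The walk that stays at node i. *)
Lemma transition_product_diag_ge i k :
  (\sum_(j < k) tau i j.+1 w)%:E <= transition_product g p tau k w i i.
Proof.
elim: k => [|k IHk]; first by rewrite big_ord0; exact: mpid_diag_ge.
rewrite big_ord_recr /= addrC; apply: mpmul_diag_ge => //.
rewrite -[tau i k.+1 w]add0r; apply: mpmul_diag_ge; last by rewrite mxE eqxx.
apply: mppow_diag_ge; rewrite mxE le_max; apply/orP; left.
exact: mpid_diag_ge.
Qed.

Hypothesis gp : longest_path_length g p.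

(** With the potential L * rank, following an edge raises the weight by a service
   time, at most L, and lowers the potential by at least L; thus each matrix
   E + T_k G^T satisfies a potential bound with constant 0, and so do its powers.
   Only the remaining factor T_k contributes, with constant M_k. As the rank is
   at most p, the potential costs at most L p in the end. *)
Lemma transition_product_norm_le (M : nat -> R) (L : R) k :
  (forall i j, (tau i j.+1 w <= M j)%R) -> (forall j, (j < k)%N -> (M j <= L)%R) ->
  (0 <= L)%R ->
  mpnorm (transition_product g p tau k w) <= (\sum_(j < k) M j + L * p%:R)%:E.
Proof.
move=> tauM ML L0; have [r [rp rg]] := longest_path_rank gp.
pose phi v : R := (L * (r v)%:R)%R.
apply: (@potential_le_norm _ _ phi).
  move=> v; rewrite mulr_ge0 ?ler0n//= ler_wpM2l// ler_nat.
  exact: rp.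
elim: k ML => [|k IHk] ML.
  by rewrite big_ord0; exact: potential_le_id.
rewrite big_ord_recr /= addrC; apply: potential_le_mul; last first.
  by apply: IHk => j jk; apply: ML; exact: leqW.
rewrite -[M k]add0r; apply: potential_le_mul; last first.
  move=> i j; rewrite mxE; case: eqP => [->|_]; last exact: leNye.
  by rewrite lee_fin; have := tauM j k; lra.
apply: potential_le_pow => i j; rewrite mxE ge_max potential_le_id/= mxE.
apply/bigmax_leP; split=> [|l _]; first exact: leNye.
rewrite !mxE; case: eqP => [<-|_]; last by rewrite leNye.
case: ifPn => [/rg rji|_]; last by rewrite addeNy leNye.
rewrite adde0 lee_fin /phi; apply: le_trans (tauM i k) _.
apply: le_trans (ML k (ltnSn k)) _.
by rewrite add0r -mulrBr ler_peMr// lerBrDr nat1r ler_nat.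
Qed.

End NetworkBounds.

(** * Square integrable random variables *)

Section SquareIntegrable.
Context {d} {T : measurableType d} {R : realType} {P : probability T R}.

Lemma Lfun2_ltyP (X : T -> R) : measurable_fun setT X ->
  \int[P]_w (X w ^+ 2)%:E < +oo -> X \in Lfun P 2%:E.
Proof.
move=> mX Xoo; rewrite inE; apply/andP; split; rewrite inE//=.
rewrite /finite_norm (@lty_poweRy _ _ 2%R)// powR_Lnorm//.
rewrite (eq_integral (fun w => (X w ^+ 2)%:E))// => w _.
by rewrite /= powR_mulrn// real_normK// num_real.
Qed.

(** A finite variance says that X - c is square integrable for one constant c,
   and constants are square integrable for a probability. *)
Lemma variance_lty_Lfun2 (X : T -> R) : measurable_fun setT X ->
  'V_P[X] < +oo -> X \in Lfun P 2%:E.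
Proof.
move=> mX; rewrite /variance unlock unlock.
set c := fine _ => Voo.
have mXc : measurable_fun setT (X \- cst c)%R by exact: measurable_funB.
have Xc2 : (X \- cst c)%R \in Lfun P 2%:E.
  exact: Lfun2_ltyP.
have -> : X = ((X \- cst c) + cst c)%R by apply/funext => w; rewrite !fctE subrK.
by rewrite rpredD ?lee1n//= Lfun_cst.
Qed.

Lemma Lfun21 (X : T -> R) : X \in Lfun P 2%:E -> X \in Lfun P 1.
Proof. by apply: Lfun_subset12; exact: fin_num_measure. Qed.

Lemma measurable_deviation (X : T -> R) (c a : R) : measurable_fun setT X ->
  measurable [set w | (a <= `|X w - c|)%R].
Proof.
move=> mX; have mD : measurable_fun setT (fun w => `|X w - c|)%R.
  by apply: measurableT_comp => //; exact: measurable_funB.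
have mL : measurable_fun setT (fun w => (a <= `|X w - c|)%R).
  exact: measurable_fun_ler.
by rewrite -[X in measurable X]setTI; exact: (mL measurableT [set true]).
Qed.

End SquareIntegrable.

(** * Independence and the weak law of large numbers *)

Section Independence.
Context {d} {T : measurableType d} {R : realType} {P : probability T R}.
Variables X Y : {RV P >-> R}.
Hypothesis XY : forall A B, measurable A -> measurable B ->
  P (X @^-1` A `&` Y @^-1` B) = P (X @^-1` A) * P (Y @^-1` B).
Hypothesis (X2 : (X : T -> R) \in Lfun P 2%:E)
  (Y2 : (Y : T -> R) \in Lfun P 2%:E).

Let joint (w : T) := (X w, Y w).

Let mjoint : measurable_fun setT joint.
Proof. by apply/measurable_fun_pairP; split. Qed.

HB.instance Definition _ := isMeasurableFun.Build _ _ _ _ joint mjoint.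

(** Independence says that the law of (X, Y) agrees with the product of the laws
   of X and Y on rectangles, hence everywhere, and Fubini's theorem factors the
   integral of the product. *)
Lemma independent_expectationM : 'E_P[X \* Y] = 'E_P[X] * 'E_P[Y].
Proof.
have mM : measurable_fun setT (fun z : R * R => (z.1 * z.2)%:E).
  by apply/measurable_EFinP; apply: measurable_funM.
have XY1 : P.-integrable setT ((fun z : R * R => (z.1 * z.2)%:E) \o joint).
  exact/Lfun1_integrable/Lfun2_mul_Lfun1.
pose m1 := distribution P X; pose m2 := distribution P Y.
have prodE A : measurable A -> (m1 \x m2)%E A = distribution P joint A.
  by apply: product_measure_unique => B C mB mC; rewrite -XY.
have iM : (m1 \x m2)%E.-integrable setT (fun z : R * R => (z.1 * z.2)%:E).
  apply/integrableP; split=> //.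
  rewrite (eq_measure_integral (distribution P joint)) => [|A mA _].
    have : (distribution P joint).-integrable setT
        (fun z : R * R => (z.1 * z.2)%:E) by exact: integrable_pushforward.
    by case/integrableP.
  exact: prodE.
have iY : m2.-integrable setT EFin.
  apply: integrable_pushforward => //; exact/Lfun1_integrable/Lfun21.
have iX : m1.-integrable setT EFin.
  apply: integrable_pushforward => //; exact/Lfun1_integrable/Lfun21.
rewrite unlock; transitivity (\int[distribution P joint]_z (z.1 * z.2)%:E).
  by rewrite integral_distribution.
rewrite (eq_measure_integral (m1 \x m2)%E); last first.
  by move=> A mA _; exact/esym/prodE.
rewrite -integral12_prod_meas1// /fubini_F/=.
under eq_integral do under eq_integral do rewrite EFinM.
under eq_integral => x _ do rewrite integralZl//.
have /fineK <- : \int[m2]_y y%:E \is a fin_num by exact: integrable_fin_num.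
rewrite integralZr// fineK; last exact: integrable_fin_num.
by rewrite !integral_distribution//; exact/Lfun1_integrable/Lfun21.
Qed.

Lemma independent_covariance : covariance P X Y = 0.
Proof.
have XY1 : ((X : T -> R) \* Y)%R \in Lfun P 1 by exact: Lfun2_mul_Lfun1.
rewrite (covarianceE (Lfun21 _ X2) (Lfun21 _ Y2) XY1).
rewrite -[X in X - _]/('E_P[X \* Y]) independent_expectationM.
by rewrite subee// fin_numM// expectation_fin_num// Lfun21.
Qed.

End Independence.

(** Being in C_k for all k >= N is an event contained in each of these C_k, whose
   probabilities tend to 0; it is null, and so is the union over N. *)
Lemma ae_frequently_notin d (T : measurableType d) (R : realType)
    (P : probability T R) (C : nat -> set T) (c : R) :
  (forall k, measurable (C k)) ->
  (forall k, (0 < k)%N -> P (C k) <= (c / k%:R)%:E) ->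
  {ae P, forall w, forall N, exists2 k, (N <= k)%N & ~ C k w}.
Proof.
move=> mC PC.
have : P.-negligible (\bigcup_N \bigcap_(k in [set k | (N <= k)%N]) C k).
  apply: negligible_bigcup => N.
  have mI : measurable (\bigcap_(k in [set k | (N <= k)%N]) C k).
    exact: bigcap_measurableType.
  apply/negligibleP => //; apply/eqP; rewrite eq_le measure_ge0 andbT.
  apply/lee_addgt0Pr => e e0; rewrite add0e.
  (* An index k >= N beyond |c| / e, so that c / k <= e. *)
  pose k := (Num.truncn (`|c| / e) + N).+1.
  apply: (@le_trans _ _ (P (C k))).
    by apply: le_measure; rewrite ?inE// => w; apply => /=; rewrite /k; lia.
  apply: le_trans (PC k _) _ => //; rewrite lee_fin ler_pdivrMr// mulrC.
  rewrite -ler_pdivrMr//; apply: (@le_trans _ _ (`|c| / e)%R).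
    by rewrite ler_pM2r ?invr_gt0// ler_norm.
  by apply/ltW/(lt_le_trans (truncnS_gt _)); rewrite ler_nat /k ltnS leq_addr.
move=> CN0; apply: negligibleS CN0 => w /= /existsNP[N CN]; exists N => // k /= Nk.
by apply: contrapT => Ckw; apply: CN; exists k.
Qed.

Section WeakLaw.
Context {d} {T : measurableType d} {R : realType} {P : probability T R}.
Variables (X : nat -> {RV P >-> R}) (m v : R).
Hypothesis X2 : forall k, (X k : T -> R) \in Lfun P 2%:E.
Hypothesis Xm : forall k, 'E_P[X k] = m%:E.
Hypothesis Xv : forall k, 'V_P[X k] = v%:E.
Hypothesis Xcov : forall k l, k != l -> covariance P (X k) (X l) = 0.

Let S k : T -> R := (\sum_(j < k) (X j : T -> R))%R.

Let SE k : S k = (fun w => \sum_(j < k) X j w)%R.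
Proof. by apply/funext => w; rewrite /S fct_sumE. Qed.

Let S2 k : S k \in Lfun P 2%:E.
Proof. by rewrite rpred_sum ?lee1n// => i _; exact: X2. Qed.

Let S_mean k : 'E_P[S k] = (k%:R * m)%:E.
Proof.
elim: k => [|k IHk]; first by rewrite /S big_ord0 expectation_cst mul0r.
rewrite /S big_ord_recr/= expectationD ?Lfun21//; last exact: S2.
by rewrite IHk Xm -EFinD -natr1 mulrDl mul1r.
Qed.

Let S_cov k l : (k <= l)%N -> covariance P (S k) (X l) = 0.
Proof.
elim: k => [|k IHk] kl; first by rewrite /S big_ord0 covariance_cst_l.
rewrite /S big_ord_recr/= covarianceDl//; last exact: S2.
by rewrite IHk ?Xcov ?adde0 ?ltn_eqF// ltnW.
Qed.

Let S_variance k : 'V_P[S k] = (k%:R * v)%:E.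
Proof.
elim: k => [|k IHk]; first by rewrite /S big_ord0 variance_cst mul0r.
rewrite /S big_ord_recr/= varianceD//; last exact: S2.
by rewrite IHk Xv S_cov// mule0 adde0 -EFinD -natr1 mulrDl mul1r.
Qed.

Lemma sum_deviation k (e : R) : (0 < e)%R -> (0 < k)%N ->
  P [set w | (e * k%:R <= `|\sum_(j < k) X j w - k%:R * m|)%R] <=
  (v / e ^+ 2 / k%:R)%:E.
Proof.
move=> e0 k0; have ek0 : (0 < e * k%:R)%R by rewrite mulr_gt0 ?ltr0n.
have Sm : S k \in mfun by exact: sub_Lfun_mfun (S2 k).
have : P [set w | (e * k%:R <= `|S k w - fine 'E_P[S k]|)%R] <=
    ((e * k%:R) ^- 2)%:E * 'V_P[S k].
  exact: (chebyshev (mfun_Sub Sm)).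
rewrite S_mean S_variance SE /= -EFinM; congr (_ <= _%:E).
have ? : (k%:R != 0 :> R)%R by rewrite pnatr_eq0 -lt0n.
have ? : (e != 0)%R by rewrite gt_eqF.
by field; apply/andP.
Qed.

(** Square integrability makes each of the k events of order 1/k^2, which
   outweighs their number. *)
Lemma term_deviation k (e : R) : (0 < e)%R -> (0 < k)%N ->
  P (\bigcup_(j < k) [set w | (e * k%:R <= `|X j w - m|)%R]) <=
  (v / e ^+ 2 / k%:R)%:E.
Proof.
move=> e0 k0; have ek0 : (0 < e * k%:R)%R by rewrite mulr_gt0 ?ltr0n.
have mB j : measurable [set w | (e * k%:R <= `|X j w - m|)%R].
  exact: measurable_deviation.
rewrite bigcup_mkord.
apply: (@le_trans _ _ (\sum_(j < k) (((e * k%:R) ^- 2) * v)%:E)).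
  apply: (@le_trans _ _ (\sum_(j < k) P [set w | (e * k%:R <= `|X j w - m|)%R])).
    apply: (@content_subadditive _ _ _ P _
      (fun j => [set w | (e * k%:R <= `|X j w - m|)%R])).
    - by [].
    - exact: bigsetU_measurable.
    - by [].
  apply: lee_sum => j _; rewrite EFinM -(Xv j).
  by have := chebyshev (X j) ek0; rewrite Xm.
rewrite sumEFin lee_fin big_const_ord iter_addr_0 -mulr_natr.
have ? : (k%:R != 0 :> R)%R by rewrite pnatr_eq0 -lt0n.
have ? : (e != 0)%R by rewrite gt_eqF.
rewrite le_eqVlt; apply/orP; left; apply/eqP.
by field; apply/andP.
Qed.

(** The sum and all of its terms are controlled at the same index k, which is
   what the upper bound for the network requires. *)
Lemma ae_frequently_close (e : R) : (0 < e)%R ->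
  {ae P, forall w, forall N, exists k, [/\ (N <= k)%N,
    (`|\sum_(j < k) X j w - k%:R * m| < e * k%:R)%R &
    forall j, (j < k)%N -> (`|X j w - m| < e * k%:R)%R]}.
Proof.
move=> e0.
pose C k := [set w | (e * k%:R <= `|\sum_(j < k) X j w - k%:R * m|)%R] `|`
  \bigcup_(j < k) [set w | (e * k%:R <= `|X j w - m|)%R].
have mS k : measurable [set w | (e * k%:R <= `|\sum_(j < k) X j w - k%:R * m|)%R].
  by apply: measurable_deviation; exact: measurable_sum.
have mU k : measurable (\bigcup_(j < k) [set w | (e * k%:R <= `|X j w - m|)%R]).
  by apply: bigcup_measurable => j _; exact: measurable_deviation.
have nC : {ae P, forall w, forall N, exists2 k, (N <= k)%N & ~ C k w}.
  apply: (@ae_frequently_notin _ _ _ _ _ (v / e ^+ 2 + v / e ^+ 2)) => [k|k k0].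
    exact: measurableU.
  apply: le_trans (measureU2 _ _ _) _ => //.
  by rewrite mulrDl EFinD leeD// ?sum_deviation ?term_deviation.
apply: filterS nC => w Cw N; have [k Nk Ckw] := Cw N; exists k; split=> //.
  by rewrite ltNge; apply/negP => ?; apply: Ckw; left.
by move=> j jk; rewrite ltNge; apply/negP => ?; apply: Ckw; right; exists j.
Qed.

End WeakLaw.

(** * Functions of i.i.d. random elements *)

Section IdenticallyDistributedFunctions.
Context {d d'} {T : measurableType d} {U : measurableType d'} {R : realType}.
Context {P : probability T R}.
Variables (V : nat -> T -> U) (f : U -> R) (X : nat -> {RV P >-> R}).
Hypothesis Vindep : mutually_independent P V.
Hypothesis Vident : identically_distributed P V.
Hypothesis mf : measurable_fun setT f.
Hypothesis XE : forall k w, X k w = f (V k w).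
Hypothesis X2 : forall k, (X k : T -> R) \in Lfun P 2%:E.

Let preX k (B : set R) : X k @^-1` B = V k @^-1` (f @^-1` B).
Proof. by apply/seteqP; split=> w /=; rewrite XE. Qed.

Let mpre (B : set R) : measurable B -> measurable (f @^-1` B).
Proof. by move=> mB; rewrite -[X in measurable X]setTI; exact: mf. Qed.

Let Xident k l (B : set R) : measurable B ->
  distribution P (X k) B = distribution P (X l) B.
Proof.
by move=> mB; rewrite /distribution /pushforward !preX; apply: Vident; exact: mpre.
Qed.

Let expectation_ident (h : R -> R) k l : measurable_fun setT h ->
  P.-integrable setT (fun w => (h (X k w))%:E) ->
  P.-integrable setT (fun w => (h (X l w))%:E) ->
  'E_P[h \o X k] = 'E_P[h \o X l].
Proof.
move=> mh hk hl; rewrite unlock.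
have mEh : measurable_fun setT (EFin \o h) by exact/measurable_EFinP.
transitivity (\int[distribution P (X k)]_y (h y)%:E).
  by rewrite integral_distribution.
transitivity (\int[distribution P (X l)]_y (h y)%:E).
  by apply: eq_measure_integral => B mB _; exact: Xident.
by rewrite integral_distribution.
Qed.

Let Xindep k l (A B : set R) : k != l -> measurable A -> measurable B ->
  P (X k @^-1` A `&` X l @^-1` B) = P (X k @^-1` A) * P (X l @^-1` B).
Proof.
move=> kl mA mB; rewrite !preX.
pose D j := if j == k then f @^-1` A else f @^-1` B.
have mD j : measurable (D j) by rewrite /D; case: ifP => _; exact: mpre.
have := Vindep [:: k; l] D.
rewrite !big_cons big_nil mule1 /D eqxx eq_sym (negbTE kl) /= inE kl => <- //.
  congr (P _); apply/seteqP; split=> w /=.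
    by move=> [wA wB] j; rewrite !inE => /orP[]/eqP->;
      rewrite ?eqxx// eq_sym (negbTE kl).
  move=> wD; split.
    by have := wD k; rewrite eqxx; apply; rewrite mem_head.
  have := wD l; rewrite eq_sym (negbTE kl); apply.
  by rewrite !inE eqxx orbT.
Qed.

Lemma iid_ae_frequently_close (e : R) : (0 < e)%R ->
  {ae P, forall w, forall N, exists k, [/\ (N <= k)%N,
    (`|\sum_(j < k) X j w - k%:R * fine 'E_P[X 0%N]| < e * k%:R)%R &
    forall j, (j < k)%N -> (`|X j w - fine 'E_P[X 0%N]| < e * k%:R)%R]}.
Proof.
have X1 k : P.-integrable setT (EFin \o X k) by exact/Lfun1_integrable/Lfun21.
have E1 k : 'E_P[X k] = 'E_P[X 0%N].
  apply: (expectation_ident idfun) => //=; [|exact: X1..].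
  exact: measurable_id.
have E2 k : 'E_P[(fun x => x ^+ 2)%R \o X k] = 'E_P[(fun x => x ^+ 2)%R \o X 0%N].
  apply: expectation_ident; [|exact: Lfun2_integrable_sqr..].
  exact: measurable_funX.
apply: (@ae_frequently_close _ _ _ _ X _ (fine 'V_P[X 0%N])) => // [k|k|k l kl].
- by rewrite (E1 k) fineK// expectation_fin_num// Lfun21.
- rewrite fineK; last exact: variance_fin_num.
  rewrite (varianceE (X2 k)) (varianceE (X2 0%N)) (E1 k); congr (_ - _).
  exact: E2.
- by apply: independent_covariance => // A B; exact: Xindep.
Qed.

End IdenticallyDistributedFunctions.

(** * The largest service time of a customer *)

Section TupleMax.
Context {R : realType} {n : nat}.

(** The starting value of the iterated maximum is an entry of the tuple, so that
   negative entries are not truncated at 0. *)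
Definition tuple_max (i0 : 'I_n) (t : n.-tuple R) : R :=
  \big[Num.max/tnth t i0]_i tnth t i.

Lemma measurable_tuple_max i0 : measurable_fun setT (tuple_max i0).
Proof.
rewrite /tuple_max; elim: (index_enum _) => [|i s IHs].
  by under eq_fun do rewrite big_nil; exact: measurable_tnth.
under eq_fun do rewrite big_cons.
by apply: measurable_maxr => //; exact: measurable_tnth.
Qed.

Lemma tuple_max_ge i0 t i : (tnth t i <= tuple_max i0 t)%R.
Proof. exact: (le_bigmax _ (tnth t)). Qed.

Lemma tuple_max_sqr_le i0 t :
  (tuple_max i0 t ^+ 2 <= \sum_i tnth t i ^+ 2)%R.
Proof.
have le_sum i : (tnth t i ^+ 2 <= \sum_i tnth t i ^+ 2)%R.
  rewrite (bigD1 i)//= lerDl; apply: sumr_ge0 => j _; exact: sqr_ge0.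
rewrite /tuple_max; elim/big_ind: _ => // x y xs ys.
by rewrite /Num.max; case: ifP.
Qed.

End TupleMax.

Section ServiceVector.
Context {d} {T : measurableType d} {R : realType} {P : probability T R}.
Context {n : nat} (tau : 'I_n -> nat -> {RV P >-> R}) (i0 : 'I_n).

Lemma measurable_service_vector k : measurable_fun setT (service_vector tau k).
Proof.
apply/measurable_fun_tnthP => i.
rewrite (_ : _ \o _ = tau i k)//; apply/funext => w.
by rewrite /= tnth_mktuple.
Qed.

Let max_service k w := tuple_max i0 (service_vector tau k w).

Let measurable_max_service k : measurable_fun setT (max_service k).
Proof.
by apply: measurableT_comp; [exact: measurable_tuple_max|
                             exact: measurable_service_vector].
Qed.

HB.instance Definition _ k :=
  isMeasurableFun.Build _ _ _ _ (max_service k) (measurable_max_service k).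

Definition max_service_rv k : {RV P >-> R} := max_service k.

Lemma service_matrixE k w :
  service_matrix tau k w = mpdiag (tnth (service_vector tau k w)).
Proof.
by apply/matrixP => i j; rewrite !mxE tnth_mktuple.
Qed.

Lemma mpnorm_service_matrix k w :
  mpnorm (service_matrix tau k w) = (max_service_rv k w)%:E.
Proof. by rewrite service_matrixE (mpnorm_diag _ i0). Qed.

Lemma max_service_ge i k w : (tau i k w <= max_service_rv k w)%R.
Proof.
by have := tuple_max_ge i0 (service_vector tau k w) i; rewrite tnth_mktuple.
Qed.

Lemma Lfun2_max_service k : (forall i, (tau i k : T -> R) \in Lfun P 2%:E) ->
  (max_service_rv k : T -> R) \in Lfun P 2%:E.
Proof.
move=> tau2; apply: Lfun2_ltyP => //.
apply: (@le_lt_trans _ _ (\int[P]_w \sum_i (tau i k w ^+ 2)%:E)).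
  apply: ge0_le_integral => //.
  - by move=> w _; rewrite lee_fin sqr_ge0.
  - by apply/measurable_EFinP; exact: measurable_funX.
  - by apply: emeasurable_sum => i; apply/measurable_EFinP; exact: measurable_funX.
  - move=> w _; rewrite sumEFin lee_fin.
    apply: le_trans (tuple_max_sqr_le _ _) _.
    by apply: ler_sum => i _; rewrite tnth_mktuple.
rewrite ge0_integral_sum//; first last.
- by move=> i w _; rewrite lee_fin sqr_ge0.
- by move=> i; apply/measurable_EFinP; exact: measurable_funX.
apply: lte_sum_pinfty => i _.
exact: (integrable_lty measurableT (Lfun2_integrable_sqr (tau2 i))).
Qed.

End ServiceVector.

(** * Comparison with the limit *)

Lemma average_cvg_bounds (R : realType) (u : nat -> \bar R) (l e : R) :
  (k%:R^-1)%:E * u k @[k --> \oo] --> l%:E -> (0 < e)%R ->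
  exists N, forall k, (N <= k)%N -> (0 < k)%N ->
    ((l - e) * k%:R)%:E <= u k <= ((l + e) * k%:R)%:E.
Proof.
move=> /fine_cvgP[ufin /cvgrPdist_le ul] e0.
have [N _ HN] := filterI ufin (ul _ e0).
exists N => k Nk k0; have [/= + /=] := HN k Nk.
have ki0 : (0 < k%:R^-1 :> R)%R by rewrite invr_gt0 ltr0n.
case: (u k) => [x _||]; last 2 first.
- by rewrite gt0_muley ?lte_fin.
- by rewrite gt0_muleNy ?lte_fin.
rewrite /= ler_distlC => /andP[lo hi].
have k0R : (0 < k%:R :> R)%R by rewrite ltr0n.
rewrite !lee_fin mulrC [((l + e) * _)%R]mulrC.
by rewrite -(ler_pdivlMl _ _ k0R) -(ler_pdivrMl _ _ k0R) lo.
Qed.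

Section CycleTimeBounds.
Context {d : measure_display} {T : measurableType d} {R : realType}.
Context {P : probability T R} {n : nat} {g : rel 'I_n} {p : nat}.
Context {tau : 'I_n -> nat -> {RV P >-> R}} {gamma : R}.
Hypothesis tau2 : forall i k, (tau i k.+1 : T -> R) \in Lfun P 2%:E.
Hypothesis tau_indep :
  mutually_independent P (fun k => service_vector tau k.+1).
Hypothesis tau_ident :
  identically_distributed P (fun k => service_vector tau k.+1).
Hypothesis gammaP : mean_cycle_time g p tau gamma.

Let ae_ex (Q : T -> Prop) : {ae P, forall w, Q w} -> exists w, Q w.
Proof.
have P0 : 0 < P [set: T] by rewrite probability_setT.
exact: (@filter_ex _ _ (ae_properfilter_algebraOfSetsType P0)).
Qed.

Lemma expectation_le_cycle_time i : 'E_P[tau i 1%N] <= gamma%:E.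
Proof.
rewrite -(fineK (expectation_fin_num (Lfun21 _ (tau2 i 0%N)))).
have mtnth : measurable_fun setT (fun t : n.-tuple R => tnth t i).
  exact: measurable_tnth.
have tauE k w : tau i k.+1 w = tnth (service_vector tau k.+1 w) i.
  by rewrite tnth_mktuple.
set m := fine _; apply/lee_addgt0Pr => e e0; rewrite -EFinD lee_fin.
have e20 : (0 < e / 2)%R by rewrite divr_gt0.
have close := iid_ae_frequently_close _ _ (fun k => tau i k.+1)
  tau_indep tau_ident mtnth tauE (tau2 i) _ e20.
have [w [wcvg wclose]] := ae_ex _ (filterI gammaP close).
have [N wN] := average_cvg_bounds _ _ _ _ wcvg e20.
have [k [Nk Sk _]] := wclose N.+1.
have k0 : (0 < k%:R :> R)%R by rewrite ltr0n (leq_trans _ Nk).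
have /andP[_ Ak] := wN k (ltnW Nk) (leq_ltn_trans (leq0n N) Nk).
have := le_trans (le_trans (transition_product_diag_ge g p tau w i k)
  (mpnorm_ge _ i i)) Ak.
rewrite lee_fin => Sle.
move: Sk; rewrite ltr_distlC => /andP[_ Sge]; rewrite -/m in Sge.
rewrite -(ler_pM2r k0); lra.
Qed.

Hypothesis gp : longest_path_length g p.
Variable i0 : 'I_n.
Hypothesis tau_ge0 : {ae P, forall w, (0 <= tau i0 1%N w)%R}.

Lemma cycle_time_le_expectation_max :
  gamma%:E <= 'E_P[max_service_rv tau i0 1%N].
Proof.
have M2 k : (max_service_rv tau i0 k.+1 : T -> R) \in Lfun P 2%:E.
  exact: Lfun2_max_service.
rewrite -(fineK (expectation_fin_num (Lfun21 _ (M2 0%N)))).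
set m := fine _; apply/lee_addgt0Pr => e e0; rewrite -EFinD lee_fin.
(* The errors add up to (p + 3) c k: one c k from the convergence to gamma, one
   from the sum of the maxima, p from the term c k of the bound L = m + c k on
   each of them, and one from the term p m, which is at most c k for large k. *)
pose c := (e / (p%:R + 3))%R.
have p0 : (0 <= p%:R :> R)%R by exact: ler0n.
have c0 : (0 < c)%R by rewrite divr_gt0//; lra.
have ce : (c * (p%:R + 3) = e)%R by rewrite divfK// gt_eqF//; lra.
have close := iid_ae_frequently_close _ _ (fun k => max_service_rv tau i0 k.+1)
  tau_indep tau_ident (measurable_tuple_max i0) (fun _ _ => erefl) M2 _ c0.
have [w [[wcvg wclose] tau0]] := ae_ex _ (filterI (filterI gammaP close) tau_ge0).
have [N wN] := average_cvg_bounds _ _ _ _ wcvg c0.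
have [k [Nk Sk Mk]] := wclose (N + Num.truncn (p%:R * m / c)).+1.
have Nk1 : (N < k)%N by lia.
have k0 : (0 < k%:R :> R)%R by rewrite ltr0n (leq_trans _ Nk1).
have pm : (p%:R * m <= c * k%:R)%R.
  rewrite -ler_pdivrMl// mulrC; apply/ltW/(lt_le_trans (truncnS_gt _)).
  by rewrite ler_nat; apply: leq_trans Nk; rewrite ltnS leq_addl.
have /andP[Ak _] := wN k (ltnW Nk1) (leq_ltn_trans (leq0n N) Nk1).
have ML j : (j < k)%N -> (max_service_rv tau i0 j.+1 w <= m + c * k%:R)%R.
  by move=> /Mk; rewrite ltr_distl => /andP[_ /ltW].
have L0 : (0 <= m + c * k%:R)%R.
  apply: le_trans (ML 0%N (leq_ltn_trans (leq0n N) Nk1)).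
  exact: le_trans tau0 (max_service_ge _ _ _ _ _).
have := le_trans Ak (transition_product_norm_le g p tau w gp _ _ _
  (fun i j => max_service_ge tau i0 i j.+1 w) ML L0).
rewrite lee_fin => Ale.
move: Sk; rewrite ltr_distl => /andP[_ Slt]; rewrite -/m in Slt.
by rewrite -(ler_pM2r k0) -ce; lra.
Qed.

End CycleTimeBounds.

Theorem theorem7 (d : measure_display) (T : measurableType d) (R : realType)
    (P : probability T R) (n : nat) (g : rel 'I_n) (p : nat)
    (tau : 'I_n -> nat -> {RV P >-> R}) (gamma : R)
    (g_acyclic : acyclic_graph g)
    (p_longest : longest_path_length g p)
    (tau_ge0 : forall i k, (0 < k)%N -> {ae P, forall w, (0 <= tau i k w)%R})
    (tau_mean : forall i k, (0 < k)%N -> 'E_P[tau i k] < +oo)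
    (tau_var : forall i k, (0 < k)%N -> 'V_P[tau i k] < +oo)
    (tau_indep : mutually_independent P (fun k => service_vector tau k.+1))
    (tau_ident : identically_distributed P (fun k => service_vector tau k.+1))
    (gammaP : mean_cycle_time g p tau gamma) :
  mpnorm (mpexpect P (service_matrix tau 1)) <= gamma%:E /\
  gamma%:E <= \int[P]_w mpnorm (service_matrix tau 1 w).
Proof.
have [i0 _] := p_longest.1.
have tau2 i k : (tau i k.+1 : T -> R) \in Lfun P 2%:E.
  by apply: variance_lty_Lfun2 => //; exact: tau_var.
split; last first.
  under eq_integral do rewrite (mpnorm_service_matrix tau i0).
  rewrite -expectation_def.
  exact: (cycle_time_le_expectation_max tau2 tau_indep tau_ident gammaP p_longest
    i0 (tau_ge0 i0 1%N isT)).
apply/bigmax_leP; split=> [|i _]; first exact: leNye.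
apply/bigmax_leP; split=> [|j _]; first exact: leNye.
have [<-|ij] := eqVneq i j; last first.
  by rewrite mpexpect_Ny ?leNye// => w; rewrite mxE (negbTE ij).
rewrite mxE; have -> : \int[P]_w service_matrix tau 1 w i i = 'E_P[tau i 1%N].
  by rewrite unlock; apply: eq_integral => w _; rewrite mxE eqxx.
exact: (expectation_le_cycle_time tau2 tau_indep tau_ident gammaP i).
Qed.
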